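(* Let $\mathbb{C}$ be a finitely complete pointed category which has coequalizers and in which regular epimorphisms are stable under binary products. If $\mathbb{C}$ is unital, then $\mathbb{C}$ satisfies (P).
   Context: Property (P) for a category $\mathbb{C}$ with binary products: for any two coequalizer diagrams $C_1 \rightrightarrows X \xrightarrow{q_1} X'$ (with parallel pair $u,v$) and $C_2 \rightrightarrows Y \xrightarrow{q_2} Y'$ (with parallel pair $u',v'$) in $\mathbb{C}$, the diagram $C_1\times C_2 \rightrightarrows X\times Y \xrightarrow{q_1\times q_2} X'\times Y'$ (with parallel pair $u\times u'$, $v\times v'$) is a coequalizer diagram in $\mathbb{C}$. Regular epimorphisms being stable under binary products means that $f\times g$ is a regular epimorphism whenever $f$ and $g$ are. A binary relation $R$ between $A$ and $B$ is a subobject of $A\times B$, and for morphisms $a:S\to A$, $b:S\to B$, $a\,R\,b$ means that $(a,b):S\to A\times B$ factors through $R$. A finitely complete pointed category $\mathbb{C}$ is unital if for any binary relation $R$ in $\mathbb{C}$ between any two objects $A$ and $B$, and any generalized elements $a:S\to A$, $b:S\to B$, $a\,R\,0$ and $0\,R\,b$ imply $a\,R\,b$, where $0$ denotes zero morphisms. *)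

(* Defs.v *)
(* Morphisms are compared by Leibniz equality; [Finite] is that of FinFun. *)
From Stdlib Require Export List FinFun.

Set Implicit Arguments.
Unset Strict Implicit.
Unset Printing Implicit Defensive.

Record category := Category {
  obj :> Type;
  hom : obj -> obj -> Type;
  idm : forall A, hom A A;
  comp : forall A B C, hom B C -> hom A B -> hom A C;
  comp_idl : forall A B (f : hom A B), comp (idm B) f = f;
  comp_idr : forall A B (f : hom A B), comp f (idm A) = f;
  comp_assoc : forall A B C D (h : hom C D) (g : hom B C) (f : hom A B),
    comp h (comp g f) = comp (comp h g) f
}.

Arguments hom {c} A B : rename.
Arguments idm {c} A : rename.
Arguments comp {c A B C} g f : rename.

Declare Scope cat_scope.
Delimit Scope cat_scope with cat.
Notation "g ∘ f" := (comp g f) (at level 40, left associativity) : cat_scope.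
Open Scope cat_scope.

Record functor (J C : category) := Functor {
  fobj :> J -> C;
  fmap : forall i j : J, hom i j -> hom (fobj i) (fobj j);
  fmap_id : forall i : J, fmap (idm i) = idm (fobj i);
  fmap_comp : forall (i j k : J) (g : hom j k) (f : hom i j),
    fmap (g ∘ f) = fmap g ∘ fmap f
}.

Definition finite_category (J : category) : Prop :=
  Finite J /\ forall i j : J, Finite (hom i j).

Record cone (J C : category) (D : functor J C) := Cone {
  apex : C;
  leg : forall j : J, hom apex (D j);
  leg_natural : forall (i j : J) (f : hom i j), fmap D f ∘ leg i = leg j
}.

Record limit (J C : category) (D : functor J C) := Limit {
  lim_cone :> cone D;
  lim_lift : forall K : cone D, hom (apex K) (apex lim_cone);
  lim_fac : forall (K : cone D) (j : J), leg lim_cone j ∘ lim_lift K = leg K j;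
  lim_uniq : forall (K : cone D) (h : hom (apex K) (apex lim_cone)),
    (forall j : J, leg lim_cone j ∘ h = leg K j) -> h = lim_lift K
}.

Definition finitely_complete (C : category) : Prop :=
  forall J : category, finite_category J ->
  forall D : functor J C, inhabited (limit D).

Record zero_object (C : category) := ZeroObject {
  zero_obj :> C;
  to_zero : forall A : C, hom A zero_obj;
  to_zero_uniq : forall (A : C) (f : hom A zero_obj), f = to_zero A;
  from_zero : forall A : C, hom zero_obj A;
  from_zero_uniq : forall (A : C) (f : hom zero_obj A), f = from_zero A
}.

Definition pointed (C : category) : Prop := inhabited (zero_object C).

Definition zero_mor (C : category) (Z : zero_object C) (A B : C) : hom A B :=
  from_zero Z B ∘ to_zero Z A.

(* A chosen product diagram on A and B. A property involving products is stated
   below for every choice of them; products are unique up to isomorphism. *)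
Record product (C : category) (A B : C) := Product {
  prod_obj :> C;
  pr1 : hom prod_obj A;
  pr2 : hom prod_obj B;
  pairing : forall S : C, hom S A -> hom S B -> hom S prod_obj;
  pr1_pairing : forall (S : C) (a : hom S A) (b : hom S B), pr1 ∘ pairing a b = a;
  pr2_pairing : forall (S : C) (a : hom S A) (b : hom S B), pr2 ∘ pairing a b = b;
  pairing_uniq : forall (S : C) (a : hom S A) (b : hom S B) (h : hom S prod_obj),
    pr1 ∘ h = a -> pr2 ∘ h = b -> h = pairing a b
}.

Arguments pairing {C A B} p {S} a b.

Definition prod_map (C : category) (A B A' B' : C)
    (P : product A B) (P' : product A' B') (f : hom A A') (g : hom B B') :
    hom P P' :=
  pairing P' (f ∘ pr1 P) (g ∘ pr2 P).

Definition is_coequalizer (C : category) (A X Q : C)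
    (u v : hom A X) (q : hom X Q) : Prop :=
  q ∘ u = q ∘ v /\
  forall (T : C) (t : hom X T), t ∘ u = t ∘ v -> exists! h : hom Q T, h ∘ q = t.

Definition has_coequalizers (C : category) : Prop :=
  forall (A X : C) (u v : hom A X),
  exists (Q : C) (q : hom X Q), is_coequalizer u v q.

Definition regular_epi (C : category) (X Q : C) (q : hom X Q) : Prop :=
  exists (A : C) (u v : hom A X), is_coequalizer u v q.

Definition regular_epis_product_stable (C : category) : Prop :=
  forall (X X' Y Y' : C) (f : hom X X') (g : hom Y Y'),
  regular_epi f -> regular_epi g ->
  forall (P : product X Y) (P' : product X' Y'), regular_epi (prod_map P P' f g).

Definition monic (C : category) (R X : C) (m : hom R X) : Prop :=
  forall (T : C) (s t : hom T R), m ∘ s = m ∘ t -> s = t.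

(* The relation is the subobject represented by the monomorphism [rel_mor];
   [related] depends only on that subobject. *)
Record relation (C : category) (A B : C) (P : product A B) := Relation {
  rel_obj : C;
  rel_mor : hom rel_obj P;
  rel_monic : monic rel_mor
}.

Definition related (C : category) (A B : C) (P : product A B) (R : relation P)
    (S : C) (a : hom S A) (b : hom S B) : Prop :=
  exists h : hom S (rel_obj R), rel_mor R ∘ h = pairing P a b.

(* Zero morphisms do not depend on the zero object, so quantifying over all
   zero objects of a pointed category amounts to fixing one. *)
Definition unital (C : category) : Prop :=
  forall (Z : zero_object C) (A B : C) (P : product A B) (R : relation P)
    (S : C) (a : hom S A) (b : hom S B),
  related R a (zero_mor Z S B) -> related R (zero_mor Z S A) b -> related R a b.

Definition property_P (C : category) : Prop :=
  forall (C1 X X' : C) (u v : hom C1 X) (q1 : hom X X')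
    (C2 Y Y' : C) (u' v' : hom C2 Y) (q2 : hom Y Y'),
  is_coequalizer u v q1 -> is_coequalizer u' v' q2 ->
  forall (PC : product C1 C2) (P : product X Y) (P' : product X' Y'),
  is_coequalizer (prod_map PC P u u') (prod_map PC P v v') (prod_map P P' q1 q2).

(* Main.v *)
(** Since [q1 × q2] is a regular epimorphism, it is the coequalizer of some
    [f, g : D ⇉ X × Y], and it suffices that every [t] with
    [t ∘ (u × u') = t ∘ (v × v')] also satisfies [t ∘ f = t ∘ g]. In terms of
    generalized elements [a, b] of [D], let [a R b] mean
    [t (f1 a, f2 b) = t (g1 a, g2 b)]. Since [t (-, 0)] coequalizes [u, v], it
    factors through [q1], which coequalizes [f1, g1]; hence [1 R 0], and
    likewise [0 R 1]. Unitality then gives [1 R 1], that is,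
    [t ∘ f = t ∘ g]. *)

Require Import Defs.

Set Implicit Arguments.
Unset Strict Implicit.
Unset Printing Implicit Defensive.

(* Two objects [false], [true] and the set [E] of arrows [false -> true]: limits
   are binary products for [E] empty and equalizers for [E = bool]. *)
Definition parallel_hom (E : Type) (i j : bool) : Type :=
  match i, j with
  | false, true => E
  | true, false => Empty_set
  | _, _ => unit
  end.

Definition parallel_id (E : Type) (i : bool) : parallel_hom E i i :=
  match i with false => tt | true => tt end.

(** Two arrows compose only trivially: one of them is an identity and the composite is the other, or
    one lies in the empty type. Kept transparent so that the category and functor laws reduce by
    cases. *)
Definition parallel_comp (E : Type) (i j k : bool) :
  parallel_hom E j k -> parallel_hom E i j -> parallel_hom E i k.
Proof.
  destruct i, j, k; simpl; intros g f; first [exact g | exact f | destruct f | destruct g].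
Defined.

Definition parallel_category (E : Type) : category.
Proof.
  refine (@Category bool (parallel_hom E) (parallel_id E)
            (@parallel_comp E) _ _ _).
  - intros [] [] f; simpl in *; try destruct f; reflexivity.
  - intros [] [] f; simpl in *; try destruct f; reflexivity.
  - intros [] [] [] [] h g f; simpl in *;
      first [reflexivity | destruct f | destruct g | destruct h]; reflexivity.
Defined.

Lemma parallel_category_finite (E : Type) :
  Finite E -> finite_category (parallel_category E).
Proof.
  intros HE; split.
  - exists (true :: false :: nil); intros []; simpl; auto.
  - intros [] []; simpl; try exact HE.
    + exists (tt :: nil); intros []; simpl; auto.
    + exists nil; intros [].
    + exists (tt :: nil); intros []; simpl; auto.
Qed.

Section ParallelDiagram.
Context (C : category) (A B : C) (E : Type) (w : E -> hom A B).

Definition parallel_obj (i : bool) : C := if i then B else A.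

Definition parallel_map (i j : bool) :
  parallel_hom E i j -> hom (parallel_obj i) (parallel_obj j) :=
  match i, j with
  | false, false => fun _ => idm A
  | false, true => w
  | true, false => fun e => match e with end
  | true, true => fun _ => idm B
  end.

Definition parallel_diagram : functor (parallel_category E) C.
Proof.
  refine (@Functor (parallel_category E) C parallel_obj parallel_map _ _).
  - intros []; reflexivity.
  - intros [] [] [] g f; simpl in *;
      try (destruct f; fail); try (destruct g; fail);
      rewrite ?comp_idl, ?comp_idr; reflexivity.
Defined.

(** The leg [b] is separate data because for empty [E] it is not determined by [a]. *)
Definition parallel_cone (S : C) (a : hom S A) (b : hom S B)
  (H : forall e, w e ∘ a = b) : cone parallel_diagram.
Proof.
  refine (@Cone _ _ parallel_diagram S
    (fun j : bool => match j return hom S (parallel_obj j) with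
                     | true => b | false => a end) _).
  intros [] [] f; simpl in *; try apply comp_idl; [destruct f | apply H].
Defined.

End ParallelDiagram.

Lemma product_exists (C : category) (A B : C) :
  finitely_complete C -> inhabited (product A B).
Proof.
  intros HC.
  set (w := fun e : Empty_set => match e return hom A B with end).
  assert (HE : Finite Empty_set) by (exists nil; intros []).
  destruct (HC _ (parallel_category_finite HE) (parallel_diagram w)) as [L].
  pose (K := fun (S : C) (a : hom S A) (b : hom S B) =>
    @parallel_cone C A B Empty_set w S a b
      (fun e => match e with end)).
  constructor.
  refine (@Product C A B (apex L) (leg L false) (leg L true)
    (fun S a b => lim_lift L (K S a b)) _ _ _).
  - intros S a b; exact (lim_fac L (K S a b) false).
  - intros S a b; exact (lim_fac L (K S a b) true).
  - intros S a b h H1 H2; apply (@lim_uniq _ _ _ L (K S a b)).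
    intros []; assumption.
Qed.

Lemma equalizer_exists (C : category) (A B : C) (f g : hom A B) :
  finitely_complete C ->
  exists (Q : C) (m : hom Q A), monic m /\ f ∘ m = g ∘ m /\
    forall (S : C) (a : hom S A), f ∘ a = g ∘ a -> exists h : hom S Q, m ∘ h = a.
Proof.
  intros HC.
  set (w := fun e : bool => if e then f else g).
  assert (HE : Finite bool)
    by (exists (true :: false :: nil); intros []; simpl; auto).
  destruct (HC _ (parallel_category_finite HE) (parallel_diagram w)) as [L].
  assert (Hw : forall e : bool, w e ∘ leg L false = leg L true)
    by exact (@leg_natural _ _ _ L false true).
  pose proof (Hw true) as Hf; pose proof (Hw false) as Hg; simpl in Hf, Hg.
  exists (apex L), (leg L false); split; [|split].
  - intros S s t Hst.
    assert (HK : forall e, w e ∘ (leg L false ∘ t) = leg L true ∘ t)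
      by (intros e; rewrite comp_assoc, Hw; reflexivity).
    pose (K := parallel_cone HK).
    (* Both [s] and [t] induce the cone [K]: the leg at [true] factors through the leg at [false],
       on which they agree. *)
    transitivity (lim_lift L K); [|symmetry];
      apply (@lim_uniq _ _ _ L K); intros []; simpl; trivial.
    rewrite <- (Hw true), <- !comp_assoc, Hst; reflexivity.
  - rewrite Hf, Hg; reflexivity.
  - intros S a Ha.
    assert (HK : forall e, w e ∘ a = f ∘ a) by (intros []; simpl; auto).
    exists (lim_lift L (parallel_cone HK)).
    exact (lim_fac L (parallel_cone HK) false).
Qed.

Lemma pairing_comp (C : category) (A B : C) (P : product A B)
    (S T : C) (a : hom S A) (b : hom S B) (h : hom T S) :
  pairing P a b ∘ h = pairing P (a ∘ h) (b ∘ h).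
Proof.
  apply pairing_uniq; rewrite comp_assoc, ?pr1_pairing, ?pr2_pairing; reflexivity.
Qed.

Lemma pairing_eta (C : category) (A B : C) (P : product A B)
    (S : C) (h : hom S P) :
  pairing P (pr1 P ∘ h) (pr2 P ∘ h) = h.
Proof. symmetry; apply pairing_uniq; reflexivity. Qed.

Lemma prod_map_pairing (C : category) (A B A' B' : C)
    (P : product A B) (P' : product A' B') (f : hom A A') (g : hom B B')
    (S : C) (a : hom S A) (b : hom S B) :
  prod_map P P' f g ∘ pairing P a b = pairing P' (f ∘ a) (g ∘ b).
Proof.
  unfold prod_map.
  rewrite pairing_comp, <- !comp_assoc, pr1_pairing, pr2_pairing; reflexivity.
Qed.

Lemma zero_mor_comp_l (C : category) (Z : zero_object C) (A B D : C)
    (f : hom B D) : f ∘ zero_mor Z A B = zero_mor Z A D.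
Proof.
  unfold zero_mor; rewrite comp_assoc; f_equal; apply from_zero_uniq.
Qed.

Lemma zero_mor_comp_r (C : category) (Z : zero_object C) (A B D : C)
    (f : hom A B) : zero_mor Z B D ∘ f = zero_mor Z A D.
Proof.
  unfold zero_mor; rewrite <- comp_assoc; f_equal; apply to_zero_uniq.
Qed.

(** By the universal property [t] factors through [q], so it identifies whatever [q] identifies. *)
Lemma coequalizer_transfer (C : category) (A X Q : C) (u v : hom A X)
    (q : hom X Q) (T : C) (t : hom X T) (D : C) (f g : hom D X) :
  is_coequalizer u v q -> t ∘ u = t ∘ v -> q ∘ f = q ∘ g -> t ∘ f = t ∘ g.
Proof.
  intros [_ Hq] Ht Hfg.
  destruct (Hq T t Ht) as [h [<- _]].
  rewrite <- !comp_assoc, Hfg; reflexivity.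
Qed.

(** The equalizer of [f] and [g] is a subobject of [P], hence a relation; it relates two elements
    exactly when [f] and [g] agree on their pairing. Unitality is applied to this relation. *)
Lemma unital_parallel_eq (C : category) (Z : zero_object C) (A B T S : C)
    (P : product A B) (f g : hom P T) (a : hom S A) (b : hom S B) :
  finitely_complete C -> unital C ->
  f ∘ pairing P a (zero_mor Z S B) = g ∘ pairing P a (zero_mor Z S B) ->
  f ∘ pairing P (zero_mor Z S A) b = g ∘ pairing P (zero_mor Z S A) b ->
  f ∘ pairing P a b = g ∘ pairing P a b.
Proof.
  intros HC HU Ha Hb.
  destruct (equalizer_exists f g HC) as (Q & m & Hm & Hfg & Hlift).
  destruct (HU Z A B P (Relation Hm) S a b (Hlift _ _ Ha) (Hlift _ _ Hb))
    as [h Hh]; simpl in Hh.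
  rewrite <- Hh, !comp_assoc, Hfg; reflexivity.
Qed.

Theorem proposition3 (C : category) :
  finitely_complete C ->
  pointed C ->
  has_coequalizers C ->
  regular_epis_product_stable C ->
  unital C ->
  property_P C.
Proof.
  intros HC [Z] _ HS HU C1 X X' u v q1 C2 Y Y' u' v' q2 H1 H2 PC P P'.
  split.
  (* Only the inner factors [u × u'] and [v × v'] are opened into pairings. *)
  { unfold prod_map at 2 4.
    rewrite !prod_map_pairing, !comp_assoc, (proj1 H1), (proj1 H2); reflexivity. }
  intros T t Ht.
  assert (Ht' : forall (S : C) (a : hom S C1) (b : hom S C2),
    t ∘ pairing P (u ∘ a) (u' ∘ b) = t ∘ pairing P (v ∘ a) (v' ∘ b)).
  { intros S a b.
    rewrite <- !(prod_map_pairing PC), !comp_assoc, Ht; reflexivity. }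
  assert (HR1 : regular_epi q1) by (exists C1, u, v; exact H1).
  assert (HR2 : regular_epi q2) by (exists C2, u', v'; exact H2).
  destruct (HS X X' Y Y' q1 q2 HR1 HR2 P P') as (D & f & g & Hq & Huniv).
  apply Huniv.
  assert (Hq1 : q1 ∘ (pr1 P ∘ f) = q1 ∘ (pr1 P ∘ g)).
  { apply (f_equal (comp (pr1 P'))) in Hq; unfold prod_map in Hq.
    rewrite !comp_assoc, pr1_pairing, <- !comp_assoc in Hq; exact Hq. }
  assert (Hq2 : q2 ∘ (pr2 P ∘ f) = q2 ∘ (pr2 P ∘ g)).
  { apply (f_equal (comp (pr2 P'))) in Hq; unfold prod_map in Hq.
    rewrite !comp_assoc, pr2_pairing, <- !comp_assoc in Hq; exact Hq. }
  assert (Hx : (t ∘ pairing P (idm X) (zero_mor Z X Y)) ∘ (pr1 P ∘ f)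
             = (t ∘ pairing P (idm X) (zero_mor Z X Y)) ∘ (pr1 P ∘ g)).
  { apply (coequalizer_transfer H1); [|exact Hq1].
    (* At the element [(1, 0)]: both [u'] and [v'] preserve zero, so [t (u, 0) = t (v, 0)]. *)
    pose proof (Ht' C1 (idm C1) (zero_mor Z C1 C2)) as E.
    rewrite !comp_idr, !zero_mor_comp_l in E.
    rewrite <- !comp_assoc, !pairing_comp, !comp_idl, !zero_mor_comp_r; exact E. }
  assert (Hy : (t ∘ pairing P (zero_mor Z Y X) (idm Y)) ∘ (pr2 P ∘ f)
             = (t ∘ pairing P (zero_mor Z Y X) (idm Y)) ∘ (pr2 P ∘ g)).
  { apply (coequalizer_transfer H2); [|exact Hq2].
    pose proof (Ht' C2 (zero_mor Z C2 C1) (idm C2)) as E.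
    rewrite !comp_idr, !zero_mor_comp_l in E.
    rewrite <- !comp_assoc, !pairing_comp, !comp_idl, !zero_mor_comp_r; exact E. }
  rewrite <- !(comp_assoc t), !pairing_comp, !comp_idl, !zero_mor_comp_r in Hx.
  rewrite <- !(comp_assoc t), !pairing_comp, !comp_idl, !zero_mor_comp_r in Hy.
  destruct (product_exists D D HC) as [PD].
  (* The relation [R] on [D] is the equalizer of [t ∘ (f1 × f2)] and [t ∘ (g1 × g2)], tested at the
     generic pair [(1, 1)]. *)
  pose proof (@unital_parallel_eq C Z D D T D PD
    (t ∘ prod_map PD P (pr1 P ∘ f) (pr2 P ∘ f))
    (t ∘ prod_map PD P (pr1 P ∘ g) (pr2 P ∘ g)) (idm D) (idm D) HC HU) as E.
  (* At [(1, 1)] the pairings of components recombine to [f] and [g]; the two premises become [Hx]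
     and [Hy]. *)
  rewrite <- !(comp_assoc t), !prod_map_pairing, !comp_idr, !zero_mor_comp_l,
    !pairing_eta in E.
  exact (E Hx Hy).
Qed.
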